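(* Let $n\ge1$ and $w\in S_{n+1}$. Then $$\mathfrak S_w(\mathbf x;\mathbf t)=\sum_{\pi\in\mathcal R(\widetilde\omega_{[n]};w)}\mathrm{wt}(\pi).$$
   Context: $\mathbf x=(x_1,x_2,\dots)$, $\mathbf t=(t_1,t_2,\dots)$. $S_\infty$ acts on $\mathbb Z[\mathbf t][\mathbf x]$ by permuting the $x$-variables; $s_i=(i,i+1)$; $\partial_if=(f-s_if)/(x_i-x_{i+1})$. The double Schubert polynomials $\mathfrak S_w(\mathbf x;\mathbf t)$, $w\in S_\infty$, are the unique family of homogeneous polynomials ($\deg x_i=\deg t_i=1$) with $\mathfrak S_w(\mathbf t;\mathbf t)=\delta_{w,\mathrm{id}}$ and $\partial_i\mathfrak S_w=\mathfrak S_{ws_i}$ if $\ell(ws_i)<\ell(w)$ and $0$ otherwise. A reduced word of $w$ is $(a_1,\dots,a_\ell)$ with $\ell=\ell(w)$ and $w=s_{a_1}\cdots s_{a_\ell}$. The vine word: for $1\le k\le n$ let $\omega^{(k)}_{[n]}$ be the word with letters $n^{(k)},(n-1)^{(k)},\dots,k^{(k)},\overline{k+1}^{(k)},\dots,\overline n^{(k)}$ in this order; the value of $j^{(k)}$ and of $\overline j^{(k)}$ is $j$. $\widetilde\omega_{[n]}=\omega^{(1)}_{[n]}\omega^{(2)}_{[n]}\cdots\omega^{(n)}_{[n]}$. Weights: $\mathrm{wt}(j^{(i)})=x_i-t_j$, $\mathrm{wt}(\overline j^{(i)})=t_j-t_i$. A subword $\pi$ is a subset of positions of $\widetilde\omega_{[n]}$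 read in order; $\mathrm{wt}(\pi)$ is the product of the weights of its letters; $\mathcal R(\widetilde\omega_{[n]};w)$ is the set of subwords whose sequence of values is a reduced word of $w$. *)

(* Defs.v *)
From HB Require Import structures.
From mathcomp Require Import all_boot all_order all_algebra all_fingroup.
From Stdlib Require Import ClassicalEpsilon.
From mathcomp Require Import finmap.
From mathcomp.multinomials Require Import monalg.

Set Implicit Arguments.
Unset Strict Implicit.
Unset Printing Implicit Defensive.

Import GRing.Theory.
Local Open Scope ring_scope.

(* The ring Z[t][x] = Z[x_1,x_2,...; t_1,t_2,...] (countably many     *)
(* variables of each kind).  Variable [inl k] is x_(k+1) and           *)
(* [inr k] is t_(k+1); i.e. the ring has exactly the variables         *)
(* x_i, t_i for i >= 1 and no others.                                  *)
Definition Var : choiceType := (nat + nat)%type.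
Definition P := {malg int[cmonom Var]}.

(* x_i and t_i, for i >= 1 (the index 0 is never used). *)
Definition xv (i : nat) : P := << @ucm Var (inl i.-1) >>.
Definition tv (i : nat) : P := << @ucm Var (inr i.-1) >>.

Definition subst (sigma : Var -> P) (p : P) : P :=
  mmap (fun c : int => (c%:MP : P))
       (fun m : cmonom Var => \prod_(v <- finsupp m) sigma v ^+ m v) p.

Definition homogeneous (p : P) : Prop :=
  exists d : nat, forall m : cmonom Var, m \in msupp p -> mdeg m = d.

(* Permutations of the positive integers {1,2,...}: S_infinity.        *)
(* An element of S_infinity is represented by a function nat -> nat    *)
(* (we fix 0) that is injective and fixes all large integers.          *)
Definition fin_perm (w : nat -> nat) : Prop :=
  injective w /\ w 0 = 0 /\ exists N, forall k, (N <= k)%N -> w k = k.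

Definition s (i : nat) (k : nat) : nat :=
  if k == i then i.+1 else if k == i.+1 then i else k.

Definition inv_upto (B : nat) (w : nat -> nat) : nat :=
  (\sum_(1 <= j < B) \sum_(1 <= i < j) (w j < w i))%N.

Definition has_length (w : nat -> nat) (l : nat) : Prop :=
  exists N, (forall k, (N <= k)%N -> w k = k) /\
            forall B, (N <= B)%N -> inv_upto B w = l.

Definition length_lt (v w : nat -> nat) : Prop :=
  exists l1 l2, has_length v l1 /\ has_length w l2 /\ (l1 < l2)%N.

Definition sword (a : seq nat) : nat -> nat :=
  foldr (fun i f => s i \o f) id a.

Definition reduced_word (w : nat -> nat) (a : seq nat) : Prop :=
  has_length w (size a) /\ forall k, w k = sword a k.

Definition s_act (i : nat) (f : P) : P :=
  subst (fun v => match v with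
                  | inl k => xv (s i k.+1)
                  | inr k => tv k.+1
                  end) f.

Definition eval_tt (f : P) : P :=
  subst (fun v => match v with
                  | inl k => tv k.+1
                  | inr k => tv k.+1
                  end) f.

(* g = d_i f, i.e. g = (f - s_i f)/(x_i - x_{i+1}) (exact division in the
   domain Z[t][x], written without division). *)
Definition is_ddiff (i : nat) (f g : P) : Prop :=
  (xv i - xv i.+1) * g = f - s_act i f.

Definition double_schubert_family (F : (nat -> nat) -> P) : Prop :=
  forall w, fin_perm w ->
    [/\ homogeneous (F w),
        ((forall k, w k = k) -> eval_tt (F w) = 1),
        (~ (forall k, w k = k) -> eval_tt (F w) = 0) &
        forall i, (1 <= i)%N ->
          (length_lt (w \o s i) w -> is_ddiff i (F w) (F (w \o s i))) /\
          (~ length_lt (w \o s i) w -> is_ddiff i (F w) 0)].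

(* embedding of S_{N} = 'S_N (permutations of {0..N-1}) into S_infinity
   (permutations of {1,2,...}) *)
Definition perm_emb (N : nat) (w : 'S_N) : nat -> nat :=
  fun k => match insub k.-1 : option 'I_N with
           | Some i => if k == 0%N then 0%N else (w i).+1
           | None => k
           end.

(* The vine word.  A letter is (i, j, b): b = false is j^(i),          *)
(* b = true is \bar j^(i); its value is j.                             *)
Definition letter := (nat * nat * bool)%type.

Definition lval (l : letter) : nat := l.1.2.

Definition lwt (l : letter) : P :=
  let: (i, j, b) := l in if b then tv j - tv i else xv i - tv j.

Definition omega (n k : nat) : seq letter :=
  [seq (k, j, false) | j <- rev (iota k (n.+1 - k))] ++
  [seq (k, j, true) | j <- iota k.+1 (n - k)].

Definition vine (n : nat) : seq letter :=
  flatten [seq omega n k | k <- iota 1 n].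

Definition decide (Q : Prop) : bool :=
  if excluded_middle_informative Q then true else false.

(* Main.v *)
Require Import Defs.
From HB Require Import structures.
From mathcomp Require Import all_boot all_order all_algebra all_fingroup.
From mathcomp Require Import finmap.
From mathcomp.multinomials Require Import monalg.
From mathcomp Require Import ring zify.
From Stdlib Require Import FunctionalExtensionality.
Local Open Scope ring_scope.

(** In the nilCoxeter algebra put [h_i(c) = 1 + c u_i].  The subword sums are
    the coefficients of [G = A_1(x_1) ... A_n(x_n)], where
    [A_k(x) = h_n(x-t_n) ... h_k(x-t_k) h_(k+1)(t_(k+1)-t_k) ... h_n(t_n-t_k)].
    At [x = t] every [A_k] telescopes to 1.  A Yang-Baxter argument gives
    [A_i(x) A_(i+1)(y) h_i(y-x) = A_i(y) A_(i+1)(x)], i.e.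
    [s_i G = G h_i(x_(i+1)-x_i)], which says that the coefficients of [G]
    satisfy the divided-difference recursion.  By induction on the length, the
    difference between [F w] and the coefficient of [G] at [w] is symmetric in
    all of [x_1, x_2, ...], hence free of [x], hence equal to its value 0 at
    [x = t].

    An element of the algebra is represented by its coefficient function on
    permutations, and [nilmul i], [hmul i c] are right multiplication by [u_i]
    and [h_i(c)], so that products are read from the innermost application
    outwards. *)

Import GRing.Theory.
Set Implicit Arguments.
Unset Strict Implicit.
Unset Printing Implicit Defensive.

(** * The nilCoxeter algebra and the Yang-Baxter equation *)

Lemma sL i : s i i = i.+1.
Proof. by rewrite /s eqxx. Qed.

Lemma sR i : s i i.+1 = i.
Proof. by rewrite /s eqxx; case: eqP => // /eqP; rewrite eqn_leq ltnn. Qed.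

Lemma sD i k : k != i -> k != i.+1 -> s i k = k.
Proof. by rewrite /s => /negPf -> /negPf ->. Qed.

Lemma sK i : involutive (s i).
Proof.
move=> k; have [->|ki] := eqVneq k i; first by rewrite sL sR.
by have [->|kj] := eqVneq k i.+1; [rewrite sR sL | rewrite !(@sD i k)].
Qed.

Lemma comp_sK (w : nat -> nat) i : (w \o s i) \o s i = w.
Proof. by apply: functional_extensionality => k /=; rewrite sK. Qed.

Lemma comp_sC (w : nat -> nat) i j :
  (i.+1 < j)%N -> (w \o s i) \o s j = (w \o s j) \o s i.
Proof.
move=> ij; apply: functional_extensionality => k /=; congr (w _).
by rewrite /s; do ! case: eqP => /=; lia.
Qed.

Lemma comp_s_braid (w : nat -> nat) i :
  ((w \o s i) \o s i.+1) \o s i = ((w \o s i.+1) \o s i) \o s i.+1.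
Proof.
apply: functional_extensionality => k /=; congr (w _).
by rewrite /s; do ! case: eqP => /=; lia.
Qed.

Section NilCoxeter.
Variable K : comRingType.

Implicit Types (phi : (nat -> nat) -> K) (i j m d : nat) (a b c x y z : K).

(** In phi u_i the coefficient at w comes from w s_i, provided i is a descent of w. The descent is
    tested on values, which keeps lengths out of the algebra. *)
Definition nilmul i phi : (nat -> nat) -> K :=
  fun w => if (w i.+1 < w i)%N then phi (w \o s i) else 0.

Definition hmul i c phi : (nat -> nat) -> K :=
  fun w => phi w + c * nilmul i phi w.

Lemma nilmul_nilmul i phi w : nilmul i (nilmul i phi) w = 0.
Proof.
rewrite /nilmul /= sL sR; case: ltnP => // h1.
by rewrite ltnNge ltnW.
Qed.

Lemma nilmulC i j phi w : (i.+1 < j)%N ->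
  nilmul i (nilmul j phi) w = nilmul j (nilmul i phi) w.
Proof.
move=> ij; rewrite /nilmul comp_sC //= !sD //; try lia.
by case: ifP; case: ifP.
Qed.

Lemma nilmul_braid i phi w :
  nilmul i (nilmul i.+1 (nilmul i phi)) w =
  nilmul i.+1 (nilmul i (nilmul i.+1 phi)) w.
Proof.
(* Both sides make the same three comparisons among [w i], [w i.+1] and [w i.+2], in opposite
   orders. *)
rewrite /nilmul comp_s_braid /= !sL !sR.
rewrite (@sD i i.+2) ?(@sD i.+1 i) ?sL ?sR ?(@sD i i.+2); try lia.
by do 3 case: (_ < _)%N.
Qed.

Lemma nilmul_hmul i j c phi w :
  nilmul i (hmul j c phi) w = nilmul i phi w + c * nilmul i (nilmul j phi) w.
Proof. by rewrite /nilmul /hmul /nilmul; case: ifP => _; rewrite ?mulr0 ?addr0. Qed.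

Lemma hmulE i c phi w : hmul i c phi w = phi w + c * nilmul i phi w.
Proof. by []. Qed.

Lemma hmul0 i phi : hmul i 0 phi = phi.
Proof. by apply: functional_extensionality => w; rewrite /hmul mul0r addr0. Qed.

Lemma hmulD i a b phi : hmul i b (hmul i a phi) = hmul i (a + b) phi.
Proof.
apply: functional_extensionality => w.
by rewrite !hmulE nilmul_hmul nilmul_nilmul; ring.
Qed.

Lemma hmul_cancel i a b phi : a + b = 0 -> hmul i b (hmul i a phi) = phi.
Proof. by move=> ab; rewrite hmulD ab hmul0. Qed.

Lemma hmulC i j a b phi : (i.+1 < j)%N ->
  hmul i a (hmul j b phi) = hmul j b (hmul i a phi).
Proof.
move=> ij; apply: functional_extensionality => w.
by rewrite !hmulE !nilmul_hmul nilmulC //; ring.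
Qed.

Lemma nilmul_nilmul_hmul i j k c phi w :
  nilmul i (nilmul j (hmul k c phi)) w =
  nilmul i (nilmul j phi) w + c * nilmul i (nilmul j (nilmul k phi)) w.
Proof.
rewrite {1}/nilmul; case: ifP => h; last by rewrite /nilmul h mulr0 addr0.
by rewrite nilmul_hmul /nilmul h.
Qed.

(** As u_i^2 = 0, the linear terms agree because the middle parameter is the sum of the outer two,
    and the cubic terms agree by the braid relation. *)
Lemma hmul_yang_baxter i a b phi :
  hmul i b (hmul i.+1 (a + b) (hmul i a phi)) =
  hmul i.+1 a (hmul i (a + b) (hmul i.+1 b phi)).
Proof.
apply: functional_extensionality => w.
rewrite !(hmulE, nilmul_hmul, nilmul_nilmul_hmul) !nilmul_nilmul.
by rewrite nilmul_braid; ring.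
Qed.

(** * Rows of the vine word and the exchange of adjacent variables *)

Variable t : nat -> K.

(* [descend d m x], [ascend d m x] and [vine_shift d m x y] multiply on the
   right by D(x) = h_n(x - t_n) ... h_m(x - t_m), by D(x)^-1 and by
   D(x)^-1 D(y), where n = m + d - 1. *)
Fixpoint descend d m x phi :=
  if d is d'.+1 then hmul m (x - t m) (descend d' m.+1 x phi) else phi.

Fixpoint ascend d m x phi :=
  if d is d'.+1 then ascend d' m.+1 x (hmul m (t m - x) phi) else phi.

Fixpoint vine_shift d m x y phi :=
  if d is d'.+1 then
    hmul m (y - t m) (vine_shift d' m.+1 x y (hmul m (t m - x) phi))
  else phi.

Lemma descendK d m x phi : ascend d m x (descend d m x phi) = phi.
Proof.
elim: d m phi => //= d IH m phi.
by rewrite hmul_cancel ?IH //; ring.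
Qed.

Lemma descend_ascend d m x y phi :
  descend d m y (ascend d m x phi) = vine_shift d m x y phi.
Proof. by elim: d m phi => //= d IH m phi; rewrite IH. Qed.

Lemma vine_shift_descend d m x y phi :
  vine_shift d m x y (descend d m x phi) = descend d m y phi.
Proof. by rewrite -descend_ascend descendK. Qed.

Lemma vine_shift_id d m x phi : vine_shift d m x x phi = phi.
Proof.
elim: d m phi => //= d IH m phi.
by rewrite IH hmul_cancel //; ring.
Qed.

Lemma vine_shift_trans d m x y z phi :
  vine_shift d m y z (vine_shift d m x y phi) = vine_shift d m x z phi.
Proof.
elim: d m phi => //= d IH m phi.
by rewrite hmul_cancel ?IH //; ring.
Qed.

Lemma hmul_ascend i c d m x phi : (i.+1 < m)%N ->
  hmul i c (ascend d m x phi) = ascend d m x (hmul i c phi).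
Proof.
elim: d m phi => //= d IH m phi im.
by rewrite IH 1?ltnW // hmulC.
Qed.

Lemma hmul_vine_shift i c d m x y phi : (i.+1 < m)%N ->
  hmul i c (vine_shift d m x y phi) = vine_shift d m x y (hmul i c phi).
Proof.
elim: d m phi => //= d IH m phi im.
by rewrite hmulC // IH 1?ltnW // hmulC.
Qed.

Lemma vine_shift_yang_baxter d m x y z phi :
  hmul m (y - x) (vine_shift d m.+1 z y (hmul m (x - z) phi)) =
  vine_shift d m.+1 z x (hmul m (y - z) (vine_shift d m.+1 x y phi)).
Proof.
elim: d m x y z phi => [|d IH] m x y z phi.
  by rewrite /= !hmulD; congr hmul; ring.
(* The induction hypothesis at [x := t m.+1] gives the alternative
   factorisation [E'(t,v) h_(m+1)(v-u) E'(u,t)] of the shift. *)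
have shiftE u v psi : vine_shift d.+1 m.+1 u v psi =
    vine_shift d m.+2 u (t m.+1)
      (hmul m.+1 (v - u) (vine_shift d m.+2 (t m.+1) v psi)).
  by rewrite -IH.
rewrite !shiftE !(hmul_vine_shift _ _ _ _ _ (leqnn _)).
(* On the right-hand side the shifts from x to [t m.+1] and back now meet and cancel. *)
rewrite vine_shift_trans vine_shift_id.
have := @hmul_yang_baxter m (x - z) (y - x)
  (vine_shift d m.+2 (t m.+1) y phi).
have -> : x - z + (y - x) = y - z by ring.
by move=> <-; rewrite (@hmul_vine_shift m (x - z)).
Qed.

(** The factor A_k(x). Its barred half is the inverse, at t_k, of the descending product over the
    letters above k, hence the collapse at x = t_k. *)
Definition vine_row n k x phi :=
  ascend (n - k) k.+1 (t k) (descend (n.+1 - k) k x phi).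

Lemma vine_row_id n k phi : vine_row n k (t k) phi = phi.
Proof.
rewrite /vine_row; case: (leqP k n) => kn.
  by rewrite subSn //= subrr hmul0 descendK.
by rewrite (eqP (kn : n.+1 - k == 0)%N) (eqP (ltnW kn : n - k == 0)%N).
Qed.

(** The barred half of row i+1 commutes with u_i. The barred half of row i and the descending half
    of row i+1 merge into the shift from t_i to y, so the relation for shifts applies with z =
    t_i. *)
Lemma vine_row_exchange n i x y phi : (i < n)%N ->
  hmul i (y - x) (vine_row n i.+1 y (vine_row n i x phi)) =
  vine_row n i.+1 x (vine_row n i y phi).
Proof.
move=> ltin; rewrite /vine_row subSS hmul_ascend //; congr ascend.
rewrite [(n.+1 - i)%N]subSn 1?ltnW //= !descend_ascend vine_shift_yang_baxter.
by rewrite vine_shift_descend.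
Qed.

Lemma hmul_vine_row n i k c x phi : (i.+1 < k)%N ->
  hmul i c (vine_row n k x phi) = vine_row n k x (hmul i c phi).
Proof.
move=> ik; rewrite /vine_row hmul_ascend 1?ltnW //; congr ascend.
move: (n.+1 - k)%N => d; elim: d k ik => //= d IH k ik.
by rewrite hmulC // IH // ltnW.
Qed.

Lemma vine_row_last n x y phi :
  hmul n (y - x) (vine_row n n x phi) = vine_row n n y phi.
Proof.
by rewrite /vine_row subnn subSnn /= hmulD; congr hmul; ring.
Qed.

Definition vine_rows n (xs : nat -> K) ks phi :=
  foldl (fun psi k => vine_row n k (xs k) psi) phi ks.

Lemma vine_rows_cat n xs ks ks' phi :
  vine_rows n xs (ks ++ ks') phi = vine_rows n xs ks' (vine_rows n xs ks phi).
Proof. exact: foldl_cat. Qed.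

Lemma eq_vine_rows n xs xs' ks phi :
  {in ks, xs =1 xs'} -> vine_rows n xs ks phi = vine_rows n xs' ks phi.
Proof.
elim: ks phi => //= k ks IH phi eqxs.
rewrite eqxs ?mem_head //; apply: IH => j jks.
by apply: eqxs; rewrite in_cons jks orbT.
Qed.

Lemma vine_rows_id n ks phi : vine_rows n t ks phi = phi.
Proof. by elim: ks phi => //= k ks IH phi; rewrite vine_row_id IH. Qed.

Lemma hmul_vine_rows n i c xs ks phi : {in ks, forall k, (i.+1 < k)%N} ->
  hmul i c (vine_rows n xs ks phi) = vine_rows n xs ks (hmul i c phi).
Proof.
elim: ks phi => //= k ks IH phi gtks.
rewrite IH ?hmul_vine_row ?gtks ?mem_head // => j jks.
by apply: gtks; rewrite in_cons jks orbT.
Qed.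

(** Rows before i are unaffected by the swap, and rows after i+1 use only letters that commute with
    u_i; what remains is the exchange of rows i and i+1. *)
Lemma vine_rows_exchange n i xs phi : (1 <= i <= n)%N ->
  hmul i (xs i.+1 - xs i) (vine_rows n xs (iota 1 n) phi) =
  vine_rows n (xs \o s i) (iota 1 n) phi.
Proof.
case: i => // i /= ltin.
have -> : iota 1 n = iota 1 i ++ i.+1 :: iota i.+2 (n - i.+1).
  by rewrite -[n in LHS](subnKC ltin) addSnnS iotaD add1n.
rewrite !vine_rows_cat (@eq_vine_rows n (xs \o s i.+1) xs (iota 1 i)); last first.
  by move=> k; rewrite mem_iota => /= lek; rewrite sD //; lia.
move: (vine_rows n xs (iota 1 i) phi) => {}phi.
(* The last row has no successor: it is the single factor h_n, whose parameter absorbs the change of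
   variable. *)
have [eqin|ltin1] := eqVneq i.+1 n.
  by rewrite eqin subnn /= vine_row_last sL.
have -> : (n - i.+1 = (n - i.+2).+1)%N by lia.
rewrite /= sL sR hmul_vine_rows => [|k]; last by rewrite mem_iota; lia.
rewrite vine_row_exchange; last by lia.
apply: eq_vine_rows => k; rewrite mem_iota => /= lek.
by rewrite sD //; lia.
Qed.

(** * Expansion of products into sums over subwords *)

Definition nilword u phi := foldl (fun psi i => nilmul i psi) phi u.

Lemma nilword_hmul u i c phi w :
  nilword u (hmul i c phi) w = nilword u phi w + c * nilword (i :: u) phi w.
Proof.
elim/last_ind: u w => [|u j IH] w //.
rewrite -rcons_cons /nilword !foldl_rcons -!/(nilword _ _) /nilmul.
by case: ifP => _; rewrite ?mulr0 ?addr0 // IH.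
Qed.

(** Each factor 1 + c u_i contributes one of its two terms, and the mask records the choice. The
    initial [phi] is arbitrary because the induction on [L] changes it. *)
Lemma foldl_hmul_mask (T : Type) (val : T -> nat) (wt : T -> K) L phi w :
  foldl (fun psi l => hmul (val l) (wt l) psi) phi L w =
  \sum_(m : (size L).-tuple bool)
     (\prod_(l <- mask m L) wt l) * nilword (map val (mask m L)) phi w.
Proof.
elim: L phi => [|l L IH] phi /=.
  rewrite (big_pred1 [tuple]) => [|m]; last exact/esym/eqP/tuple0.
  by rewrite big_nil mul1r.
rewrite IH; under [LHS]eq_bigr => m _ do rewrite nilword_hmul mulrDr.
rewrite big_split /=.
rewrite (reindex (fun p : bool * (size L).-tuple bool => cons_tuple p.1 p.2)) /=;
  last first.
  exists (fun m : (size L).+1.-tuple bool => (thead m, behead_tuple m)) => [[b m] _|m _].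
    by congr pair; apply/val_inj.
  by case/tupleP: m => b m; apply/val_inj.
rewrite -(pair_bigA _ (fun (b : bool) (m : (size L).-tuple bool) =>
   (\prod_(l' <- mask (b :: m) (l :: L)) wt l') *
   nilword (map val (mask (b :: m) (l :: L))) phi w)) big_bool /= addrC.
by congr (_ + _); apply: eq_bigr => m _; rewrite big_cons mulrCA mulrA.
Qed.

End NilCoxeter.

Lemma rmorph_foldl_hmul (K K' : comRingType) (f : {rmorphism K -> K'})
    (T : Type) (val : T -> nat) (wt : T -> K) (wt' : T -> K')
    (phi : (nat -> nat) -> K) (phi' : (nat -> nat) -> K') L w :
  (forall l, f (wt l) = wt' l) -> (forall v, f (phi v) = phi' v) ->
  f (foldl (fun psi l => hmul (val l) (wt l) psi) phi L w) =
  foldl (fun psi l => hmul (val l) (wt' l) psi) phi' L w.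
Proof.
move=> fwt fphi; elim/last_ind: L w => [|L l IH] w //=.
rewrite !foldl_rcons !hmulE rmorphD rmorphM IH fwt; congr (_ + _ * _).
by rewrite /nilmul; case: ifP => _; rewrite ?IH ?rmorph0.
Qed.

(** [lwt] with arbitrary values for the variables, so that substituted weights keep the same
    form. *)
Definition vine_weight (K : comRingType) (xs ts : nat -> K) (l : letter) : K :=
  let: (i, j, b) := l in if b then ts j - ts i else xs i - ts j.

Lemma foldl_vine (K : comRingType) (xs ts : nat -> K) n phi :
  foldl (fun psi l => hmul (lval l) (vine_weight xs ts l) psi) phi (vine n) =
  vine_rows ts n xs (iota 1 n) phi.
Proof.
rewrite /vine; elim: (iota 1 n) phi => //= k ks IH phi.
rewrite foldl_cat IH /omega foldl_cat; congr vine_rows.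
have descE d m psi : foldl (fun psi l => hmul (lval l) (vine_weight xs ts l) psi)
    psi [seq (k, j, false) | j <- rev (iota m d)] = descend ts d m (xs k) psi.
  by elim: d m psi => //= d IHd m psi; rewrite rev_cons map_rcons foldl_rcons IHd.
rewrite descE /vine_row; move: (descend _ _ _ _ _) => {}phi.
by elim: (n - k)%N (k.+1) phi => //= d IHd m phi; rewrite IHd.
Qed.

(** * Substitutions in the polynomial ring *)

Definition monom_eval (sigma : Var -> P) (m : cmonom Var) : P :=
  \prod_(v <- finsupp m) sigma v ^+ m v.

Lemma monom_evalEw (sigma : Var -> P) (m : cmonom Var) (d : {fset Var}) :
  (finsupp m `<=` d)%fset -> monom_eval sigma m = \prod_(v <- d) sigma v ^+ m v.
Proof.
move=> md; rewrite /monom_eval (big_fset_incl _ md) // => v _.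
by rewrite -cmE_eq0 => /eqP ->; rewrite expr0.
Qed.

Lemma monom_eval_mmorphism (sigma : Var -> P) : mmorphism (monom_eval sigma).
Proof.
split=> [m1 m2|]; last by rewrite /monom_eval mdom1 big_seq_fset0.
rewrite {1}/monom_eval mdomD.
rewrite (@monom_evalEw _ m1 (finsupp m1 `|` finsupp m2)%fset) ?fsubsetUl //.
rewrite (@monom_evalEw _ m2 (finsupp m1 `|` finsupp m2)%fset) ?fsubsetUr //.
by rewrite -big_split /=; apply: eq_bigr => v _; rewrite cmM exprD.
Qed.

HB.instance Definition _ sigma :=
  monalg.isMultiplicative.Build _ _ (monom_eval sigma) (monom_eval_mmorphism sigma).

Lemma substE sigma p : subst sigma p = mmap (@malgC _ int) (monom_eval sigma) p.
Proof. by []. Qed.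

Lemma subst_is_additive sigma : additive (subst sigma).
Proof. by move=> p q; rewrite !substE mmapB. Qed.

Lemma subst_is_multiplicative sigma : multiplicative (subst sigma).
Proof.
exact: (@mmap_is_multiplicative _ _ _ (@malgC _ int) (monom_eval sigma)).
Qed.

HB.instance Definition _ sigma :=
  GRing.isAdditive.Build P P (subst sigma) (subst_is_additive sigma).
HB.instance Definition _ sigma :=
  GRing.isMultiplicative.Build P P (subst sigma) (subst_is_multiplicative sigma).

Definition var (v : Var) : P := << @ucm Var v >>.

Lemma subst_var sigma v : subst sigma (var v) = sigma v.
Proof.
rewrite substE /var mmapU /= mul1r /monom_eval mdomU big_seq_fset1.
by rewrite cmUU expr1.
Qed.

Lemma substC sigma c : subst sigma c%:MP = c%:MP.
Proof. by rewrite substE mmapC. Qed.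

Lemma monomE (m : cmonom Var) : << m >> = monom_eval var m :> P.
Proof.
elim: {m}(mdeg m) {-2}m (erefl (mdeg m)) => [|d IH] m dm.
  rewrite (mdeg_eq0I dm) /monom_eval mdom1 big_seq_fset0 //.
have [v vm] : exists v, v \in finsupp m.
  case: (fset_0Vmem (finsupp m)) => [m0|[v vm]]; last by exists v.
  by move: dm; rewrite mdegE m0 big_seq_fset0.
have mE : m = mmul (ucm v) (divcm m (ucm v)).
  apply/eqP/cmP => u; rewrite cmM cmU divcmE ucmE.
  have : m v != 0%N by rewrite cmE_neq0.
  by case: (v =P u) => [<-|_]; lia.
have dm' : mdeg (divcm m (ucm v)) = d.
  by move: dm; rewrite {1}mE mdegM mdegU add1n => -[].
rewrite mE (monom_eval_mmorphism var).1 -(IH _ dm') /monom_eval.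
rewrite mdomU big_seq_fset1 cmUU expr1.
by rewrite /var malgM_def fgmulUU mulr1.
Qed.

(** Constants and variables generate the ring: a polynomial is a sum of scaled monomials, and a
    monomial is a product of variables. *)
Lemma P_ind (Q : P -> Prop) :
  (forall c : int, Q c%:MP) -> (forall v, Q (var v)) ->
  (forall p q, Q p -> Q q -> Q (p + q)) ->
  (forall p q, Q p -> Q q -> Q (p * q)) -> forall p, Q p.
Proof.
move=> QC Qv QD QM p; rewrite [p]monalgE.
have Q0 : Q 0 by rewrite -malgC0E; exact: QC.
have Q1 : Q 1 by rewrite -mpolyC1E; exact: QC.
apply: (big_ind Q Q0 QD) => m _.
have -> : << p@_m *g m >> = (p@_m)%:MP * << m >> :> P.
  by rewrite malgM_def fgmulUU mulr1 mul1m.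
apply: (QM); first exact: QC.
rewrite monomE; apply: (big_ind Q Q1 QM) => v _.
elim: (m v) => [|k IH]; first by rewrite expr0.
rewrite exprS; exact (QM _ _ (Qv v) IH).
Qed.

Lemma eq_rmorph_var (f g : {rmorphism P -> P}) :
  (forall c : int, f c%:MP = g c%:MP) -> (forall v, f (var v) = g (var v)) ->
  f =1 g.
Proof.
move=> eqC eqv; elim/P_ind => // p q eqp eqq.
  by rewrite !rmorphD eqp eqq.
by rewrite !rmorphM eqp eqq.
Qed.

Lemma subst_comp sigma rho p :
  subst sigma (subst rho p) = subst (subst sigma \o rho) p.
Proof.
apply: (@eq_rmorph_var (subst sigma \o subst rho) (subst (subst sigma \o rho))) => /=.
  by move=> c; rewrite !substC.
by move=> v; rewrite !subst_var.
Qed.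

Lemma eq_subst sigma rho p : sigma =1 rho -> subst sigma p = subst rho p.
Proof.
move=> eqs; apply: (@eq_rmorph_var (subst sigma) (subst rho)) => [c|v] /=.
  by rewrite !substC.
by rewrite !subst_var.
Qed.

Lemma subst_id p : subst var p = p.
Proof.
apply: (@eq_rmorph_var (subst var) idfun) => [c|v] /=.
  by rewrite substC.
by rewrite subst_var.
Qed.

Lemma xvE k : xv k.+1 = var (inl k). Proof. by []. Qed.

Lemma tvE k : tv k.+1 = var (inr k). Proof. by []. Qed.

Lemma subst_x sigma k : subst sigma (xv k) = sigma (inl k.-1).
Proof. exact: subst_var. Qed.

Lemma subst_t sigma k : subst sigma (tv k) = sigma (inr k.-1).
Proof. exact: subst_var. Qed.

(** Keeps x_1, ..., x_N and sends every later x_k to t_k. It interpolates between the substitution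
    of [eval_tt], at N = 0, and the identity. *)
Definition xtail_to_t N (v : Var) : P :=
  match v with inl k => if (k < N)%N then xv k.+1 else tv k.+1 | inr k => tv k.+1 end.

Lemma xtail_to_t_fixed p :
  exists N, forall M, (N <= M)%N -> subst (xtail_to_t M) p = p.
Proof.
elim/P_ind: p => [c|v|p q [N fixp] [N' fixq]|p q [N fixp] [N' fixq]].
- by exists 0%N => M _; rewrite substC.
- case: v => k; exists k.+1 => M kM; rewrite subst_var /xtail_to_t ?kM.
    exact: xvE.
  exact: tvE.
- exists (maxn N N') => M; rewrite geq_max => /andP[NM N'M].
  by rewrite rmorphD /= fixp ?fixq.
exists (maxn N N') => M; rewrite geq_max => /andP[NM N'M].
by rewrite rmorphM /= fixp ?fixq.
Qed.

(* If [x_(N+2), x_(N+3), ...] do not occur in [p], then [s_(N+1) p] does not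
   involve [x_(N+1)]; when it equals [p], neither does [p].  The substitution
   operator is abstract because comparing concrete polynomials by conversion
   does not terminate in practice. *)
Lemma xtail_to_t_step_abstract (R : Type) (ev : (Var -> R) -> R -> R)
    (x t : nat -> R)
    (ev_comp : forall sigma rho p, ev sigma (ev rho p) = ev (ev sigma \o rho) p)
    (eq_ev : forall sigma rho p, sigma =1 rho -> ev sigma p = ev rho p)
    (ev_x : forall sigma k, ev sigma (x k) = sigma (inl k.-1))
    (ev_t : forall sigma k, ev sigma (t k) = sigma (inr k.-1)) p N :
  let swap v := match v with inl k => x (s N.+1 k.+1) | inr k => t k.+1 end in
  let tail M v := match v with
    | inl k => if (k < M)%N then x k.+1 else t k.+1
    | inr k => t k.+1 end in
  ev swap p = p -> ev (tail N.+1) p = p -> ev (tail N) p = p.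
Proof.
move=> swap tail symp fixp.
(* [sigma] replaces x_(N+1) alone. It fixes p because p is also the swap of a polynomial free of
   x_(N+2), and so is free of x_(N+1). *)
pose sigma (v : Var) : R :=
  match v with inl k => if k == N then t N.+1 else x k.+1 | inr k => t k.+1 end.
have sigmax k : k != N -> ev sigma (x k.+1) = x k.+1.
  by move=> kN; rewrite ev_x /= (negPf kN).
have sigmaN : ev sigma (x N.+1) = t N.+1 by rewrite ev_x /= eqxx.
have sigmat k : ev sigma (t k.+1) = t k.+1 by rewrite ev_t.
have sigmap : ev sigma p = p.
  rewrite -symp -fixp !ev_comp; apply: eq_ev => -[k|k]; last first.
    by rewrite /= !ev_t /= sigmat.
  rewrite /= ltnS; case: leqP => kN; last by rewrite !ev_t /= sigmat.
  rewrite !(ev_x _ k.+1) /= /s !eqSS; case: eqP => [_|/eqP kN'].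
    by apply: sigmax; rewrite eqn_leq ltnn.
  by case: eqP => [|_]; [lia | exact: sigmax].
(* [tail N] is [tail N.+1] followed by [sigma]. *)
rewrite -[RHS]sigmap -[in RHS]fixp ev_comp.
apply: eq_ev => -[k|k]; last by rewrite /= sigmat.
rewrite /= ltnS [(k <= N)%N]leq_eqVlt; have [->|kN] := eqVneq k N.
  by rewrite ltnn /= sigmaN.
by case: ltnP => kN'; rewrite /= ?sigmax ?sigmat.
Qed.

Lemma xtail_to_t_step p N :
  s_act N.+1 p = p -> subst (xtail_to_t N.+1) p = p ->
  subst (xtail_to_t N) p = p.
Proof.
exact: (xtail_to_t_step_abstract subst_comp eq_subst subst_x subst_t).
Qed.

(** Only finitely many variables occur in p, so some [xtail_to_t N] fixes it; symmetry lowers N step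
    by step to 0. *)
Lemma eval_tt_symmetric p :
  (forall i, (1 <= i)%N -> s_act i p = p) -> eval_tt p = p.
Proof.
move=> symp; have [N fixp] := xtail_to_t_fixed p.
have {fixp} : subst (xtail_to_t N) p = p by exact: fixp.
elim: N => [|N IH] fixp; last exact: (IH (xtail_to_t_step (symp N.+1 isT) fixp)).
by apply: etrans fixp; apply: eq_subst => -[k|k]; exact: erefl.
Qed.

(** * Lengths and reduced words *)

Lemma decideP Q : reflect Q (decide Q).
Proof.
by rewrite /decide; case: ClassicalEpsilon.excluded_middle_informative => h;
  constructor.
Qed.

(** Swapping positions i and i+1 permutes all other pairs of positions among themselves, so only the
    pair (i, i+1) changes the count. The additive form avoids truncated subtraction. *)
Lemma inv_upto_comp_s B w i : (1 <= i)%N -> (i.+1 < B)%N ->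
  (inv_upto B (w \o s i) + (w i.+1 < w i) =
   inv_upto B w + (w i < w i.+1))%N.
Proof.
move=> i1 iB; rewrite /inv_upto.
rewrite !(@big_cat_nat _ _ _ i.+2 1 B) //=.
rewrite [in RHS](@eq_big_nat _ _ _ i.+2 B _
  (fun j => \sum_(1 <= k < j) (w (s i j) < w (s i k)))%N); last first.
  move=> j /andP[ij _]; rewrite (@sD i j); try lia.
  rewrite !(@big_cat_nat _ _ _ i 1 j) //=; try lia.
  congr (_ + _)%N.
    by apply: eq_big_nat => k /andP[_ ki]; rewrite sD //; lia.
  rewrite !(@big_ltn _ _ _ i j) 1?[in X in (_ + X)%N]big_ltn; try lia.
  rewrite [in RHS](@big_ltn _ _ _ i.+1 j); try lia.
  rewrite sL sR addnCA; congr (_ + (_ + _))%N.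
  by apply: eq_big_nat => k /andP[ki _]; rewrite sD //; lia.
move: (\sum_(i.+2 <= j < B) _)%N => rest.
rewrite !(@big_nat_recr _ _ _ i.+1 1) //= !(@big_nat_recr _ _ _ i 1) //= !sL !sR.
rewrite [in LHS](@eq_big_nat _ _ _ 1 i _
  (fun j => \sum_(1 <= k < j) (w j < w k))%N); last first.
  move=> j /andP[_ ji]; rewrite (@sD i j); try lia.
  by apply: eq_big_nat => k /andP[_ ki]; rewrite sD //; lia.
have rowE c : (\sum_(1 <= k < i) (c < w (s i k)) =
               \sum_(1 <= k < i) (c < w k))%N.
  by apply: eq_big_nat => k /andP[_ ki]; rewrite sD //; lia.
by rewrite !rowE; lia.
Qed.

Lemma fin_perm_stable w N : injective w -> (forall k, (N <= k)%N -> w k = k) ->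
  forall k, (k < N)%N -> (w k < N)%N.
Proof.
move=> injw fixw k kN; rewrite ltnNge; apply/negP => Nwk.
by have := injw _ _ (fixw _ Nwk); lia.
Qed.

(** A position beyond the support exceeds all values before it, so the count of inversions
    stabilises. *)
Lemma has_length_ex w : fin_perm w -> exists l, has_length w l.
Proof.
move=> [injw [_ [N fixw]]]; exists (inv_upto N.+1 w), N.+1; split=> [k Nk|B NB].
  by apply: fixw; lia.
rewrite /inv_upto (@big_cat_nat _ _ _ N.+1 1 B) //= [X in (_ + X)%N]big_nat_cond.
rewrite [X in (_ + X)%N]big1 ?addn0 // => j /andP[/andP[Nj _] _].
rewrite big_nat_cond big1 // => k /andP[/andP[_ kj] _].
have wkj : (w k < j)%N.
  have [Nk|kN] := leqP N k; first by rewrite fixw.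
  by have := fin_perm_stable injw fixw kN; lia.
by rewrite (fixw j (ltnW Nj)) ltnNge ltnW.
Qed.

Lemma has_length_uniq w l l' : has_length w l -> has_length w l' -> l = l'.
Proof.
move=> [N [_ lw]] [N' [_ l'w]].
by rewrite -(lw (maxn N N')) ?leq_maxl // (l'w (maxn N N')) ?leq_maxr.
Qed.

Lemma has_length_comp_s w i l l' : (1 <= i)%N ->
  has_length w l -> has_length (w \o s i) l' ->
  (l' + (w i.+1 < w i) = l + (w i < w i.+1))%N.
Proof.
move=> i1 [N [_ lw]] [N' [_ l'w]]; pose B := maxn i.+2 (maxn N N').
rewrite -(lw B) -?(l'w B) ?inv_upto_comp_s // /B; lia.
Qed.

Lemma fin_perm_comp_s w i : (1 <= i)%N -> fin_perm w -> fin_perm (w \o s i).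
Proof.
move=> i1 [injw [w0 [N fixw]]]; split; last split.
- by apply: inj_comp injw _; exact: inv_inj (@sK i).
- by rewrite /= sD //; lia.
exists (maxn N i.+2) => k; rewrite geq_max => /andP[Nk ik] /=.
by rewrite sD ?fixw //; lia.
Qed.

Lemma fin_perm_id : fin_perm id.
Proof. by split=> //; split=> //; exists 0%N. Qed.

(** Links the length condition on the Schubert family with the descent test of [nilmul]. *)
Lemma length_lt_comp_s w i : (1 <= i)%N -> fin_perm w ->
  length_lt (w \o s i) w <-> (w i.+1 < w i)%N.
Proof.
move=> i1 fw; split=> [[l1 [l2 [h1 [h2 l12]]]]|desc].
  by have := has_length_comp_s i1 h2 h1; lia.
have [l2 h2] := has_length_ex fw.
have [l1 h1] := has_length_ex (fin_perm_comp_s i1 fw).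
exists l1, l2; do 2 split=> //.
by have := has_length_comp_s i1 h2 h1; lia.
Qed.

Lemma has_length_id : has_length id 0.
Proof.
exists 0%N; split=> // B _; rewrite /inv_upto.
rewrite big_nat_cond big1 // => j _.
by rewrite big_nat_cond big1 // => k /andP[/andP[_ kj] _]; lia.
Qed.

Lemma sword_rcons u i : sword (rcons u i) = sword u \o s i.
Proof. by elim: u => //= j u ->. Qed.

Lemma fin_perm_sword u : all (leq 1) u -> fin_perm (sword u).
Proof.
elim/last_ind: u => [_|u i IH]; first exact: fin_perm_id.
rewrite all_rcons sword_rcons => /andP[i1 u1].
exact/fin_perm_comp_s/IH.
Qed.

Lemma has_length_sword_le u l :
  all (leq 1) u -> has_length (sword u) l -> (l <= size u)%N.
Proof.
elim/last_ind: u l => [l _ /has_length_uniq/(_ has_length_id) -> //|u i IH l].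
rewrite all_rcons sword_rcons size_rcons => /andP[i1 u1] lu.
have [l' lu'] := has_length_ex (fin_perm_sword u1).
by have := IH _ u1 lu'; have := has_length_comp_s i1 lu' lu; lia.
Qed.

Lemma reduced_word_nil w : reduced_word w [::] <-> forall k, w k = k.
Proof.
split=> [[] //|wid]; split=> //.
have -> : w = id by exact: functional_extensionality.
exact: has_length_id.
Qed.

Lemma reduced_word_rcons w u i : (1 <= i)%N -> all (leq 1) u -> fin_perm w ->
  reduced_word w (rcons u i) <->
  (w i.+1 < w i)%N /\ reduced_word (w \o s i) u.
Proof.
move=> i1 u1 fw; have [l' h'] := has_length_ex (fin_perm_comp_s i1 fw).
rewrite /reduced_word size_rcons sword_rcons.
split=> [[h wE]|[desc [h wE]]].
  have lE := has_length_comp_s i1 h h'.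
  have wsE : w \o s i = sword u.
    by apply: functional_extensionality => k; rewrite /= wE /= sK.
  (* Since w has length [(size u).+1], the bound [l' <= size u] forces the length to drop, which
     makes i a descent. *)
  have := has_length_sword_le u1; rewrite -wsE => /(_ _ h') l'u.
  have desc : (w i.+1 < w i)%N by lia.
  by split=> //; split=> //; have <- : l' = size u by lia.
split; last by move=> k; rewrite -{1}(comp_sK w i) /= -wE.
have [l hl] := has_length_ex fw.
by have := has_length_comp_s i1 hl h => lE; have <- : l = (size u).+1 by lia.
Qed.

Definition delta_id (w : nat -> nat) : P := (decide (forall k, w k = k))%:R.

(** Removing the last letter gives the same recursion on both sides. *)
Lemma nilword_delta_id u w : all (leq 1) u -> fin_perm w ->
  nilword u delta_id w = (decide (reduced_word w u))%:R.
Proof.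
elim/last_ind: u w => [|u i IH] w.
  move=> _ _; rewrite /nilword /= /delta_id; congr (nat_of_bool _)%:R.
  by apply/decideP/decideP; rewrite reduced_word_nil.
rewrite all_rcons => /andP[i1 u1] fw.
rewrite /nilword foldl_rcons -/(nilword _ _) /nilmul.
rewrite IH //; last exact: fin_perm_comp_s.
have redE := reduced_word_rcons i1 u1 fw.
case: ifP => desc; first by congr (nat_of_bool _)%:R;
  apply/decideP/decideP => [h|/redE[] //]; apply/redE.
by case: decideP => // /redE[]; rewrite desc.
Qed.

(** * The generating function of the vine word *)

Definition vine_sum n : (nat -> nat) -> P :=
  foldl (fun psi l => hmul (lval l) (lwt l) psi) delta_id (vine n).

Lemma vine_lval_gt0 n : all (leq 1) (map lval (vine n)).
Proof.
apply/allP => j /mapP[l /flattenP[r /mapP[k]]]; rewrite mem_iota => /andP[k1 _] ->.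
rewrite mem_cat => /orP[] /mapP[j' ]; rewrite ?mem_rev mem_iota => /andP[jk _] -> ->;
  rewrite /lval /=; lia.
Qed.

Lemma vine_sumE n w : fin_perm w ->
  vine_sum n w =
  \sum_(m : (size (vine n)).-tuple bool |
          decide (reduced_word w (map lval (mask m (vine n)))))
     \prod_(l <- mask m (vine n)) lwt l.
Proof.
move=> fw; rewrite /vine_sum foldl_hmul_mask [RHS]big_mkcond /=.
apply: eq_bigr => m _; rewrite nilword_delta_id //; last first.
  by apply/allP => j; rewrite map_mask => /mem_mask; move: j; apply/allP/vine_lval_gt0.
by case: decide; rewrite ?mulr1 ?mulr0.
Qed.

(** The unit and the u_i have integer structure constants, so a ring morphism acts only on the
    weights. *)
Lemma subst_vine_sum sigma n w :
  (forall k, sigma (inr k) = tv k.+1) ->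
  subst sigma (vine_sum n w) =
  vine_rows tv n (fun k => sigma (inl k.-1)) (iota 1 n) delta_id w.
Proof.
move=> fixt; rewrite -foldl_vine.
have fixt' k : subst sigma (tv k) = tv k by rewrite subst_t fixt.
apply: (@rmorph_foldl_hmul _ _ (subst sigma)) => [l|v] /=; last first.
  by rewrite /delta_id rmorph_nat.
case: l => -[i j] [] /=; rewrite rmorphB.
  exact: (congr2 (fun p q => p - q) (fixt' j) (fixt' i)).
exact: (congr2 (fun p q => p - q) (subst_x sigma i) (fixt' j)).
Qed.

Lemma vine_sum_rows n w :
  vine_sum n w = vine_rows tv n xv (iota 1 n) delta_id w.
Proof. by rewrite -[LHS]subst_id subst_vine_sum. Qed.

Lemma eval_tt_vine_sum n w : eval_tt (vine_sum n w) = delta_id w.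
Proof.
rewrite /eval_tt subst_vine_sum //.
by rewrite -[in RHS](@vine_rows_id _ tv n (iota 1 n) delta_id).
Qed.

Lemma s_act_vine_sum_rows n i w : (1 <= i)%N ->
  s_act i (vine_sum n w) = vine_rows tv n (xv \o s i) (iota 1 n) delta_id w.
Proof.
move=> i1; rewrite /s_act (subst_vine_sum _ _ (fun=> erefl)).
have xE : {in iota 1 n, (fun k => xv (s i k.-1.+1)) =1 xv \o s i}.
  by move=> k; rewrite mem_iota => /andP[k1 _]; rewrite /= prednK.
exact (congr1 (fun g => g w) (eq_vine_rows tv n delta_id xE)).
Qed.

Lemma s_act_vine_sum n i w : (1 <= i <= n)%N ->
  s_act i (vine_sum n w) = hmul i (xv i.+1 - xv i) (vine_sum n) w.
Proof.
move=> /[dup] lein /andP[i1 _]; apply: etrans (s_act_vine_sum_rows n w i1) _.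
have -> : vine_sum n = vine_rows tv n xv (iota 1 n) delta_id.
  by apply: functional_extensionality => v; exact: vine_sum_rows.
exact (congr1 (fun g => g w) (esym (vine_rows_exchange tv xv delta_id lein))).
Qed.

Lemma s_act_vine_sum_gt n i w : (n < i)%N ->
  s_act i (vine_sum n w) = vine_sum n w.
Proof.
move=> ltni; rewrite (s_act_vine_sum_rows _ _ (leq_ltn_trans (leq0n n) ltni)).
have xE : {in iota 1 n, xv \o s i =1 xv}.
  by move=> k; rewrite mem_iota => /andP[k1 kn]; rewrite /= sD //; lia.
rewrite vine_sum_rows.
exact (congr1 (fun g => g w) (eq_vine_rows tv n delta_id xE)).
Qed.

(** Under s_i both polynomials receive the same correction, so their difference is invariant. *)
Lemma ddiff_cancel (K : comRingType) (f g x y c : K) :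
  f - (x - y) * c - (g + (y - x) * c) = f - g.
Proof. by ring. Qed.

Lemma double_schubert_vine_sum F n w :
  double_schubert_family F -> fin_perm w ->
  (forall k, (n.+1 < k)%N -> w k = k) -> F w = vine_sum n w.
Proof.
move=> HF fw; have [l lw] := has_length_ex fw.
elim/ltn_ind: l w fw lw => l IH w fw lw fixw.
have [_ evF1 evF0 ddF] := HF w fw.
apply/eqP; rewrite -subr_eq0; apply/eqP.
(* Once symmetric, the difference equals its value at x = t, where both terms agree; the invariance
   under each s_i is checked afterwards. *)
rewrite -[LHS]eval_tt_symmetric => [|i i1].
  rewrite /eval_tt rmorphB /= -!/(eval_tt _) eval_tt_vine_sum /delta_id.
  case: decideP => [idw|nidw]; first by rewrite evF1 // subrr.
  by rewrite evF0 // subrr.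
have [dd1 dd0] := ddF i i1; have descE := length_lt_comp_s i1 fw.
rewrite /s_act rmorphB /= -!/(s_act i _).
have s_actF g : is_ddiff i (F w) g -> s_act i (F w) = F w - (xv i - xv i.+1) * g.
  by move=> ->; rewrite opprB addrC subrK.
(* For i > n, w fixes i+1 and all larger integers, so i is not a descent; and x_i, x_(i+1) do not
   occur in [vine_sum n w]. *)
have [lein|ltni] := leqP i n; last first.
  have nodesc : ~ length_lt (w \o s i) w.
    have fixi k : (i.+1 <= k)%N -> w k = k.
      by move=> ik; apply: fixw; exact: leq_trans ik.
    rewrite descE (fixi i.+1 (leqnn _)).
    by have := fin_perm_stable fw.1 fixi (leqnn i.+1); lia.
  by rewrite (s_actF _ (dd0 nodesc)) mulr0 subr0 s_act_vine_sum_gt.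
rewrite s_act_vine_sum ?i1 // hmulE /nilmul; case: ifP => desc.
  have desc' : length_lt (w \o s i) w by apply/descE.
  have [l' lw'] := has_length_ex (fin_perm_comp_s i1 fw).
  (* At a descent w s_i is shorter, and i <= n keeps its support within the first n+1 integers. *)
  rewrite (s_actF _ (dd1 desc')) (IH l' _ _ (fin_perm_comp_s i1 fw) lw').
  - exact: ddiff_cancel.
  - by have := has_length_comp_s i1 lw lw'; lia.
  by move=> k nk /=; rewrite sD ?fixw //; lia.
have nodesc : ~ length_lt (w \o s i) w by rewrite descE desc.
by rewrite (s_actF _ (dd0 nodesc)); exact: ddiff_cancel.
Qed.

(** * Finite permutations inside the infinite symmetric group, and the conclusion *)

Lemma perm_emb_out N (w : 'S_N) k : (N < k)%N -> perm_emb w k = k.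
Proof. by case: k => // k ltNk; rewrite /perm_emb insubF //=; lia. Qed.

Lemma perm_emb_in N (w : 'S_N) (i : 'I_N) : perm_emb w i.+1 = (w i).+1.
Proof. by rewrite /perm_emb /= insubT //= => lti; congr (w _).+1; exact: val_inj. Qed.

Lemma fin_perm_emb N (w : 'S_N) : fin_perm (perm_emb w).
Proof.
have emb0 : perm_emb w 0 = 0%N by rewrite /perm_emb; case: insub.
split; last by split=> //; exists N.+1 => k; exact: perm_emb_out.
(* Injectivity is checked on three blocks, each preserved: 0, the integers 1 to N, and those above
   N. *)
have embP k : k = 0%N \/ (exists i : 'I_N, k = i.+1) \/ (N < k)%N.
  case: k => [|k]; first by left.
  right; case: (ltnP k N) => kN; last by right.
  by left; exists (Ordinal kN).
move=> j k; case: (embP j) => [->|[[i ->]|Nj]]; case: (embP k) => [->|[[i' ->]|Nk]];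
  rewrite ?emb0 ?perm_emb_in ?perm_emb_out //; try by have := ltn_ord (w i); lia.
- by move=> [] /val_inj/perm_inj ->.
- by have := ltn_ord (w i'); lia.
Qed.

(* Subwords of the vine word are the masks m (subsets of positions read in
   order); mask m (vine n) is the subword, map lval its value sequence. *)
Theorem theorem6p1 (F : (nat -> nat) -> P) (HF : double_schubert_family F)
    (n : nat) (hn : (1 <= n)%N) (w : 'S_n.+1) :
  F (perm_emb w) =
  \sum_(m : (size (vine n)).-tuple bool |
          decide (reduced_word (perm_emb w) (map lval (mask m (vine n)))))
     \prod_(l <- mask m (vine n)) lwt l.
Proof.
rewrite -vine_sumE; last exact: fin_perm_emb.
apply: double_schubert_vine_sum => //; first exact: fin_perm_emb.
by move=> k; exact: perm_emb_out.
Qed.
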